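(* Let $\mathcal{X}\subseteq\mathbb{R}^d$ be nonempty, closed and convex, and let $f=\frac1n\sum_{i=1}^nf_i$, where each $f_i:\mathbb{R}^d\to\mathbb{R}$ is convex, differentiable and $L_i$-smooth on an open convex set containing $\mathcal{X}$. Let $x_\star\in\operatorname{arg\,min}_{x\in\mathcal{X}}f(x)$, assume each $f_i$ has a constrained minimizer $x_{\star,i}\in\operatorname{arg\,min}_{x\in\mathcal{X}}f_i(x)$, and let $D:=\max_i\|x_{\star,i}-x_\star\|$, $L_{\max}:=\max_iL_i$, $\bar L_2^2:=\frac1n\sum_{i=1}^nL_i^2$. Let $x_0\in\mathcal{X}$, sample $i_k$ uniformly from $\{1,\dots,n\}$ independently of the past, and set $x_{k+1}\in\operatorname{arg\,min}_{z\in\mathcal{X}\cap\mathcal{B}(x_k,t_k)}\langle\nabla f_{i_k}(x_k),z\rangle$ with $t_k:=\|\nabla f_{i_k}(x_k)-\nabla f_{i_k}(x_{\star,i_k})\|/L_{i_k}$ if $\nabla f_{i_k}(x_k)\ne\nabla f_{i_k}(x_{\star,i_k})$ and $t_k:=0$ otherwise. Then for every $K\ge1$, $$\min_{0\le k\le K-1}\mathbb{E}\|\nabla f(x_k)-\nabla f(x_\star)\|\le\sqrt{\frac{4L_{\max}^2\|x_0-x_\star\|^2}{K}+(8L_{\max}^2+2\bar L_2^2)D^2}.$$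
   Context: $\|\cdot\|$ is the Euclidean norm, $\mathcal{B}(x,t):=\{y:\|y-x\|\le t\}$; $L_i$-smooth: $\nabla f_i$ is $L_i$-Lipschitz. *)

(* Defs.v *)
From HB Require Import structures.
From mathcomp Require Import all_boot all_order all_algebra.
From mathcomp Require Import all_classical all_reals all_analysis.
Set Implicit Arguments. Unset Strict Implicit. Unset Printing Implicit Defensive.
Import Order.TTheory GRing.Theory Num.Theory.
Import numFieldNormedType.Exports.
Local Open Scope classical_set_scope.
Local Open Scope ring_scope.

Definition dotp {R : realType} {d : nat} (u v : 'rV[R]_d) : R :=
  \sum_(j < d) u ord0 j * v ord0 j.
Definition enorm {R : realType} {d : nat} (v : 'rV[R]_d) : R :=
  Num.sqrt (dotp v v).

Definition convex_on {R : realType} {d : nat} (A : set 'rV[R]_d)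
  (g : 'rV[R]_d -> R) : Prop :=
  forall x y (t : R), A x -> A y -> 0 <= t -> t <= 1 ->
    g (t *: x + (1 - t) *: y) <= t * g x + (1 - t) * g y.

Definition has_gradient_on {R : realType} {d : nat} (A : set 'rV[R]_d)
  (g : 'rV[R]_d -> R) (gr : 'rV[R]_d -> 'rV[R]_d) : Prop :=
  forall x, A x -> differentiable g x /\ forall v, 'D_v g x = dotp (gr x) v.

Definition smooth_on {R : realType} {d : nat} (A : set 'rV[R]_d)
  (gr : 'rV[R]_d -> 'rV[R]_d) (L : R) : Prop :=
  forall x y, A x -> A y -> enorm (gr x - gr y) <= L * enorm (x - y).

Definition is_argmin {R : realType} {d : nat} (A : set 'rV[R]_d)
  (g : 'rV[R]_d -> R) (x : 'rV[R]_d) : Prop :=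
  A x /\ forall z, A z -> g x <= g z.

Definition eball {R : realType} {d : nat} (x : 'rV[R]_d) (t : R) : set 'rV[R]_d :=
  [set y | enorm (y - x) <= t].

Definition step_radius {R : realType} {d : nat} (g gs : 'rV[R]_d) (L : R) : R :=
  if g != gs then enorm (g - gs) / L else 0.

(* Main.v *)
Require Import Defs.
From HB Require Import structures.
From mathcomp Require Import all_boot all_order all_algebra.
From mathcomp Require Import all_classical all_reals all_analysis.
From mathcomp Require Import ring lra.
Set Implicit Arguments.
Unset Strict Implicit.
Unset Printing Implicit Defensive.

Import Order.TTheory GRing.Theory Num.Theory.
Import numFieldNormedType.Exports.
Local Open Scope classical_set_scope.
Local Open Scope ring_scope.

(* On the open convex set [U] each gradient is cocoercive,
     |g x - g y|^2 <= L <g x - g y, x - y>,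
   although the corresponding inequality between function values may fail on
   [U]. With this, the radius [t] is chosen so that the minimizer of the linear
   model over [X] and the ball satisfies
     |x_{k+1} - xs_i|^2 <= |x_k - xs_i|^2 - t^2,
   and moving the center from [xs_i] to [xstar] costs at most [2 t D]. Hence
   [t^2 / 2 <= |x_k - xstar|^2 - |x_{k+1} - xstar|^2 + 2 D^2]; averaging over the
   sampled indices and telescoping bounds the mean of [t^2], which controls the
   gradient difference because [L_i t = |g_i x_k - g_i xs_i|]. *)

(** * Euclidean inner product and norm *)

Lemma dotpC (R : realType) (d : nat) (u v : 'rV[R]_d) : dotp u v = dotp v u.
Proof. by apply: eq_bigr => j _; rewrite mulrC. Qed.

Lemma dotpDl (R : realType) (d : nat) (u v w : 'rV[R]_d) :
  dotp (u + v) w = dotp u w + dotp v w.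
Proof. by rewrite /dotp -big_split; apply: eq_bigr => j _; rewrite mxE mulrDl. Qed.

Lemma dotpZl (R : realType) (d : nat) (a : R) (u v : 'rV[R]_d) :
  dotp (a *: u) v = a * dotp u v.
Proof. by rewrite /dotp mulr_sumr; apply: eq_bigr => j _; rewrite mxE mulrA. Qed.

Lemma dotpNl (R : realType) (d : nat) (u v : 'rV[R]_d) : dotp (- u) v = - dotp u v.
Proof. by rewrite -scaleN1r dotpZl mulN1r. Qed.

Lemma dotpDr (R : realType) (d : nat) (u v w : 'rV[R]_d) :
  dotp w (u + v) = dotp w u + dotp w v.
Proof. by rewrite dotpC dotpDl !(dotpC w). Qed.

Lemma dotpZr (R : realType) (d : nat) (a : R) (u v : 'rV[R]_d) :
  dotp v (a *: u) = a * dotp v u.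
Proof. by rewrite dotpC dotpZl (dotpC v). Qed.

Lemma dotpNr (R : realType) (d : nat) (u v : 'rV[R]_d) : dotp v (- u) = - dotp v u.
Proof. by rewrite dotpC dotpNl (dotpC v). Qed.

Definition dotpE := (dotpDl, dotpDr, dotpNl, dotpNr, dotpZl, dotpZr).

Lemma dotp_ge0 (R : realType) (d : nat) (u : 'rV[R]_d) : 0 <= dotp u u.
Proof. by apply: sumr_ge0 => j _; rewrite -expr2 sqr_ge0. Qed.

Lemma dotp_eq0 (R : realType) (d : nat) (u : 'rV[R]_d) : dotp u u = 0 -> u = 0.
Proof.
move=> /psumr_eq0P u0; apply/rowP => j; rewrite mxE.
apply/eqP; rewrite -sqrf_eq0 expr2; apply/eqP/u0 => // i _.
by rewrite -expr2 sqr_ge0.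
Qed.

Lemma enorm_ge0 (R : realType) (d : nat) (u : 'rV[R]_d) : 0 <= enorm u.
Proof. exact: sqrtr_ge0. Qed.

Lemma enorm_sqr (R : realType) (d : nat) (u : 'rV[R]_d) : enorm u ^+ 2 = dotp u u.
Proof. by rewrite sqr_sqrtr ?dotp_ge0. Qed.

Lemma enormZ (R : realType) (d : nat) (a : R) (u : 'rV[R]_d) :
  enorm (a *: u) = `|a| * enorm u.
Proof.
by rewrite /enorm dotpZl dotpZr mulrA -expr2 sqrtrM ?sqr_ge0// sqrtr_sqr.
Qed.

Lemma enorm_sqrD (R : realType) (d : nat) (u v : 'rV[R]_d) :
  enorm (u + v) ^+ 2 = enorm u ^+ 2 + 2 * dotp u v + enorm v ^+ 2.
Proof. by rewrite !enorm_sqr !dotpE (dotpC v u); ring. Qed.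

Lemma enormB (R : realType) (d : nat) (u v : 'rV[R]_d) : enorm (u - v) = enorm (v - u).
Proof. by rewrite -opprB -scaleN1r enormZ normrN1 mul1r. Qed.

(** Cauchy-Schwarz, by expanding the squared norm of [enorm v *: u - enorm u *: v]. The expansion is
    divided by [enorm u * enorm v], so vanishing norms are treated first. *)
Lemma dotp_le (R : realType) (d : nat) (u v : 'rV[R]_d) :
  dotp u v <= enorm u * enorm v.
Proof.
have [u0|u0] := eqVneq (enorm u) 0.
  have /dotp_eq0 -> : dotp u u = 0 by rewrite -enorm_sqr u0 expr0n.
  by rewrite -(scale0r 0) dotpZl mul0r mulr_ge0 ?enorm_ge0.
have [v0|v0] := eqVneq (enorm v) 0.
  have /dotp_eq0 -> : dotp v v = 0 by rewrite -enorm_sqr v0 expr0n.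
  by rewrite -(scale0r 0) dotpZr mul0r mulr_ge0 ?enorm_ge0.
have uv : 0 < enorm u * enorm v by rewrite mulr_gt0 // lt_neqAle eq_sym ?u0 ?v0 enorm_ge0.
rewrite -(ler_pM2l uv).
have := dotp_ge0 (enorm v *: u - enorm u *: v).
rewrite !dotpE -!enorm_sqr (dotpC v u); nra.
Qed.

Lemma dotp_ge (R : realType) (d : nat) (u v : 'rV[R]_d) :
  - (enorm u * enorm v) <= dotp u v.
Proof. by rewrite lerNl -dotpNl (le_trans (dotp_le _ _))// -scaleN1r enormZ normrN1 mul1r. Qed.

Lemma coord_le_enorm (R : realType) (d : nat) (u : 'rV[R]_d) j :
  `|u ord0 j| <= enorm u.
Proof.
rewrite -sqrtr_sqr ler_wsqrtr// /dotp (bigD1 j)//= -expr2 lerDl.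
by apply: sumr_ge0 => i _; rewrite -expr2 sqr_ge0.
Qed.

(** Sum the tangent bound [2 * m * a i - m ^+ 2 <= a i ^+ 2] taken at the mean [m]. *)
Lemma sqr_sum_le (R : realType) (I : finType) (a : I -> R) :
  (\sum_i a i) ^+ 2 <= #|I|%:R * \sum_i a i ^+ 2.
Proof.
have [I0|I0] := posnP #|I|.
  by rewrite big_pred0 ?expr0n ?I0 ?mul0r// => i; move: (card0_eq I0 i).
have N0 : 0 < #|I|%:R :> R by rewrite ltr0n.
pose m := (\sum_i a i) / #|I|%:R.
have Sm : \sum_i a i = #|I|%:R * m by rewrite /m mulrCA divff ?mulr1 // gt_eqF.
have : \sum_i (2 * m * a i - m ^+ 2) <= \sum_i a i ^+ 2.
  by apply: ler_sum => i _; have := sqr_ge0 (a i - m); lra.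
rewrite sumrB -mulr_sumr sumr_const -mulr_natl Sm => h.
rewrite -(ler_pM2l N0) in h; lra.
Qed.

Lemma enorm_sum_sqr_le (R : realType) (d : nat) (I : finType) (v : I -> 'rV[R]_d) :
  enorm (\sum_i v i) ^+ 2 <= #|I|%:R * \sum_i enorm (v i) ^+ 2.
Proof.
rewrite enorm_sqr (eq_bigr (fun i => \sum_(j < d) v i ord0 j ^+ 2)); last first.
  by move=> i _; rewrite enorm_sqr; apply: eq_bigr => j _; rewrite expr2.
rewrite exchange_big mulr_sumr; apply: ler_sum => j _.
by rewrite -expr2 summxE sqr_sum_le.
Qed.

(** * Convex and open sets *)

Lemma convex_combo (R : realType) (d : nat) (A : set 'rV[R]_d) (x y : 'rV[R]_d) (t : R) :
  convex_set A -> A x -> A y -> 0 <= t -> t <= 1 -> A (t *: x + (1 - t) *: y).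
Proof.
move=> cA Ax Ay t0 t1.
have t01 : Itv.spec (@Itv.num_sem R) (Itv.Real `[0%Z, 1%Z]%R) t.
  by rewrite /Itv.spec/= /Itv.num_sem/= realE t0/= in_itv/= t0 t1.
have := cA x y (Itv.mk t01).
by rewrite !inE; apply.
Qed.

Lemma convex_segment (R : realType) (d : nat) (A : set 'rV[R]_d) (x v : 'rV[R]_d) (t : R) :
  convex_set A -> A x -> A (x + v) -> 0 <= t -> t <= 1 -> A (x + t *: v).
Proof.
move=> cA Ax Ay t0 t1; have := convex_combo cA Ay Ax t0 t1.
congr A; apply/rowP => j; rewrite !mxE; ring.
Qed.

(** Row vectors carry the topology of the max norm, which the Euclidean norm dominates by
    [coord_le_enorm]. *)
Lemma open_enorm_ball (R : realType) (d : nat) (U : set 'rV[R]_d) (x : 'rV[R]_d) :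
  open U -> U x -> exists2 r, 0 < r & forall v, enorm v < r -> U (x + v).
Proof.
move=> oU Ux; have /nbhs_ballP[r /= r0 rU] := open_nbhs_nbhs (conj oU Ux).
exists r => // v vr; apply: rU; rewrite -ball_normE /= opprD addrA subrr sub0r normrN.
rewrite [`|v|]mx_normrE; apply/bigmax_ltP; split => // -[i j] _ /=.
by rewrite (ord1 i) (le_lt_trans (coord_le_enorm _ _)).
Qed.

(** * First-order conditions *)

(** The directional derivative is a limit of difference quotients from the right, so a bound on them
    for small positive [t] passes to the limit. *)
Lemma gradient_le (R : realType) (d : nat) (U : set 'rV[R]_d) f g (x v : 'rV[R]_d) (c : R) :
  has_gradient_on U f g -> U x ->
  (forall t, 0 < t -> t <= 1 -> f (x + t *: v) - f x <= t * c) ->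
  dotp (g x) v <= c.
Proof.
move=> hg Ux hc; have [df <-] := hg x Ux.
have /cvg_ex[l hl] : derivable f x v by exact: diff_derivable.
have hl' := cvg_dnbhs_at_right hl.
rewrite /derive (cvg_lim _ hl)//.
apply: (cvgr_to_le hl'); near=> t.
have t0 : 0 < t by near: t; exact: nbhs_right_gt.
have t1 : t <= 1 by near: t; exact: nbhs_right_le.
by rewrite /= [_ *: _]/(_ * _) ler_pdivrMl// [_ + x]addrC hc.
Unshelve. all: by end_near. Qed.

Lemma gradient_ge (R : realType) (d : nat) (U : set 'rV[R]_d) f g (x v : 'rV[R]_d) (c : R) :
  has_gradient_on U f g -> U x ->
  (forall t, 0 < t -> t <= 1 -> t * c <= f (x + t *: v) - f x) ->
  c <= dotp (g x) v.
Proof.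
move=> hg Ux hc; have [df <-] := hg x Ux.
have /cvg_ex[l hl] : derivable f x v by exact: diff_derivable.
have hl' := cvg_dnbhs_at_right hl.
rewrite /derive (cvg_lim _ hl)//.
apply: (cvgr_to_ge hl'); near=> t.
have t0 : 0 < t by near: t; exact: nbhs_right_gt.
have t1 : t <= 1 by near: t; exact: nbhs_right_le.
by rewrite /= [_ *: _]/(_ * _) ler_pdivlMl// [_ + x]addrC hc.
Unshelve. all: by end_near. Qed.

Lemma convex_gradient_le (R : realType) (d : nat) (U : set 'rV[R]_d) f g
    (x y : 'rV[R]_d) :
  convex_on U f -> has_gradient_on U f g -> U x -> U y ->
  f x + dotp (g x) (y - x) <= f y.
Proof.
move=> cf hg Ux Uy; rewrite addrC -lerBrDr.
apply: (gradient_le hg Ux) => t t0 t1.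
have := cf y x t Uy Ux (ltW t0) t1.
have -> : t *: y + (1 - t) *: x = x + t *: (y - x).
  by apply/rowP => j; rewrite !mxE; ring.
lra.
Qed.

Lemma argmin_gradient_ge0 (R : realType) (d : nat) (X U : set 'rV[R]_d) f g
    (x y : 'rV[R]_d) :
  X `<=` U -> convex_set X -> has_gradient_on U f g -> is_argmin X f x -> X y ->
  0 <= dotp (g x) (y - x).
Proof.
move=> XU cX hg [Xx xmin] Xy.
apply: (gradient_ge hg (XU _ Xx)) => t t0 t1; rewrite mulr0 subr_ge0.
apply: xmin; apply: (convex_segment cX Xx) => //; last exact: ltW.
by rewrite addrC subrK.
Qed.

(** * Smoothness: descent inequality and cocoercivity *)

Lemma le_add_div_nat (R : realType) (a b c : R) :
  0 <= c -> (forall N, (0 < N)%N -> a <= b + c / N%:R) -> a <= b.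
Proof.
move=> c0 h; apply/ler_addgt0Pr => e e0.
have := h (Num.truncn (c / e)).+1 isT.
move/le_trans; apply; rewrite lerD2l ler_pdivrMr ?ltr0n//.
by rewrite mulrC -ler_pdivrMr// ltW// truncnS_gt.
Qed.

(** In place of an integral along the segment: cut it into [N] pieces, use convexity at the far end
    of each, bound the gradient there by smoothness, and let [N] grow. *)
Lemma descent (R : realType) (d : nat) (U : set 'rV[R]_d) f g (L : R)
    (y v : 'rV[R]_d) :
  convex_set U -> convex_on U f -> has_gradient_on U f g -> smooth_on U g L ->
  0 <= L -> U y -> U (y + v) ->
  f (y + v) <= f y + dotp (g y) v + L / 2 * enorm v ^+ 2.
Proof.
move=> cU cf hg sg L0 Uy Uyv.
have C0 : 0 <= L / 2 * enorm v ^+ 2 by rewrite mulr_ge0 ?sqr_ge0//; lra.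
apply: (le_add_div_nat C0) => N N0.
have N0' : 0 < N%:R :> R by rewrite ltr0n.
pose p j : 'rV[R]_d := y + (j%:R / N%:R) *: v.
have Up j : (j <= N)%N -> U (p j).
  move=> jN; apply: (convex_segment cU Uy Uyv); first by rewrite divr_ge0.
  by rewrite ler_pdivrMr// mul1r ler_nat.
(* The [i]-th piece costs [L * i / N^2 * enorm v ^+ 2]; summing over [i] from 1 to [j] gives the
   last term. At [j = N] it exceeds the target only by a multiple of [1 / N]. *)
have H j : (j <= N)%N -> f (p j) <= f y + j%:R / N%:R * dotp (g y) v +
    L / 2 * enorm v ^+ 2 * (j%:R * (j%:R + 1)) / N%:R ^+ 2.
  elim: j => [|j IH] jN.
    by rewrite /p !mul0r mulr0 scale0r mul0r !addr0.
  have {}IH := IH (ltnW jN).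
  have := convex_gradient_le cf hg (Up _ jN) (Up _ (ltnW jN)).
  have -> : p j - p j.+1 = - N%:R^-1 *: v.
    by apply/rowP => k; rewrite !mxE -natr1; ring.
  rewrite dotpZr => h1.
  have h2 : dotp (g (p j.+1)) v <= dotp (g y) v + L * (j.+1%:R / N%:R) * enorm v ^+ 2.
    rewrite -lerBlDl -dotpNl -dotpDl (le_trans (dotp_le _ _))// expr2 mulrA.
    rewrite ler_wpM2r ?enorm_ge0// (le_trans (sg _ _ (Up _ jN) Uy))//.
    rewrite /p addrAC subrr add0r enormZ ger0_norm ?divr_ge0//.
    by rewrite mulrA.
  have h3 : N%:R^-1 * dotp (g (p j.+1)) v <=
     N%:R^-1 * (dotp (g y) v + L * (j.+1%:R / N%:R) * enorm v ^+ 2).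
    by rewrite ler_wpM2l// invr_ge0 ltW.
  apply: (le_trans (_ : _ <= f (p j) + N%:R^-1 * dotp (g (p j.+1)) v)); first by lra.
  apply: (le_trans (lerD IH h3)); rewrite le_eqVlt; apply/orP; left; apply/eqP.
  by rewrite -natr1; field; rewrite gt_eqF.
have := H N (leqnn N).
rewrite /p divff ?gt_eqF// scale1r => /le_trans; apply.
rewrite le_eqVlt; apply/orP; left; apply/eqP.
by field; rewrite gt_eqF.
Qed.

(* [x] minimizes the convex function [f - <g x, .>], which a gradient step of
   length 1/L from [y] decreases by at least [`|g y - g x|^2 / (2 L)]. *)
Lemma smooth_gradient_gap (R : realType) (d : nat) (U : set 'rV[R]_d) f g (L : R)
    (x y : 'rV[R]_d) :
  convex_set U -> convex_on U f -> has_gradient_on U f g -> smooth_on U g L ->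
  0 < L -> U x -> U y -> U (y + L^-1 *: (g x - g y)) ->
  f x + dotp (g x) (y - x) + (2 * L)^-1 * enorm (g y - g x) ^+ 2 <= f y.
Proof.
move=> cU cf hg sg L0 Ux Uy Uz.
have := descent cU cf hg sg (ltW L0) Uy Uz.
have := convex_gradient_le cf hg Ux Uz.
have -> : y + L^-1 *: (g x - g y) - x = (y - x) + L^-1 *: (g x - g y).
  by rewrite addrAC.
rewrite dotpDr dotpZr => h1 h2.
have {h2} := le_trans h1 h2.
rewrite dotpZr enormZ exprMn real_normK ?num_real// !enorm_sqr => h.
set w := g y - g x in h *.
have -> : dotp w w = dotp (g x - g y) (g x - g y).
  by rewrite -opprB dotpNl dotpNr opprK.
have e : dotp (g y) (g x - g y) = dotp (g x) (g x - g y) - dotp (g x - g y) (g x - g y).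
  by rewrite dotpDl dotpNl; ring.
rewrite e in h.
have e2 a : L / 2 * (L^-1 ^+ 2 * a) = L^-1 * a - (2 * L)^-1 * a.
  by field; rewrite gt_eqF.
rewrite e2 in h; lra.
Qed.

(* Near the boundary of [U] the gradient steps of [smooth_gradient_gap] may leave [U];
   they stay inside for the pieces of a fine subdivision of [x, y], and
   cocoercivity on the pieces adds up by Cauchy-Schwarz. *)
Lemma cocoercive (R : realType) (d : nat) (U : set 'rV[R]_d) f g (L : R)
    (x y : 'rV[R]_d) :
  open U -> convex_set U -> convex_on U f -> has_gradient_on U f g -> smooth_on U g L ->
  0 < L -> U x -> U y ->
  enorm (g y - g x) ^+ 2 <= L * dotp (g y - g x) (y - x).
Proof.
move=> oU cU cf hg sg L0 Ux Uy.
have [r1 r10 hr1] := open_enorm_ball oU Ux.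
have [r2 r20 hr2] := open_enorm_ball oU Uy.
pose r := Num.min r1 r2.
have r0 : 0 < r by rewrite lt_min r10.
pose N := (Num.truncn (enorm (y - x) / r)).+1.
have N0' : 0 < N%:R :> R by rewrite ltr0n.
have hN : enorm (y - x) / N%:R < r.
  by rewrite ltr_pdivrMr// mulrC -ltr_pdivrMr// truncnS_gt.
pose p j : 'rV[R]_d := x + (j%:R / N%:R) *: (y - x).
(* Balls of radius [r] around both endpoints lie in [U], hence by convexity so do those around every
   [p j]. *)
have Up j v : (j <= N)%N -> enorm v < r -> U (p j + v).
  rewrite lt_min => jN /andP[vr1 vr2].
  have -> : p j + v = (x + v) + (j%:R / N%:R) *: (y - x) by rewrite /p addrAC.
  have Uyv : U (x + v + (y - x)).
    have -> : x + v + (y - x) = y + v by apply/rowP => k; rewrite !mxE; ring.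
    exact: hr2.
  apply: (convex_segment cU (hr1 _ vr1) Uyv); first by rewrite divr_ge0.
  by rewrite ler_pdivrMr// mul1r ler_nat.
have Up0 j : (j <= N)%N -> U (p j).
  move=> jN; rewrite -[p j]addr0; apply: Up => //.
  by rewrite -(scale0r 0) enormZ normr0 mul0r.
have pS j : p j.+1 - p j = N%:R^-1 *: (y - x).
  by apply/rowP => k; rewrite !mxE -natr1; ring.
have piece j : (j < N)%N -> enorm (g (p j.+1) - g (p j)) ^+ 2 <=
    L / N%:R * dotp (g (p j.+1) - g (p j)) (y - x).
  move=> jN.
  (* By smoothness the gradient step is no longer than the piece itself, which the choice of [N]
     makes shorter than [r]. *)
  have small : enorm (g (p j.+1) - g (p j)) / L < r.
    apply: le_lt_trans hN; rewrite ler_pdivrMr// mulrC.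
    apply: (le_trans (sg _ _ (Up0 _ jN) (Up0 _ (ltnW jN)))).
    by rewrite pS enormZ ger0_norm ?invr_ge0 ?ler0n// [_^-1 * _]mulrC.
  have := smooth_gradient_gap cU cf hg sg L0 (Up0 _ (ltnW jN)) (Up0 _ jN).
  have := smooth_gradient_gap cU cf hg sg L0 (Up0 _ jN) (Up0 _ (ltnW jN)).
  rewrite (enormB (g (p j)) (g (p j.+1))) => h1 h2.
  have {}h1 := h1 _; have {}h2 := h2 _.
  have U1 : U (p j + L^-1 *: (g (p j.+1) - g (p j))).
    by apply: Up; [exact: ltnW | rewrite enormZ ger0_norm ?invr_ge0 1?ltW// mulrC].
  have U2 : U (p j.+1 + L^-1 *: (g (p j) - g (p j.+1))).
    by apply: Up => //; rewrite enormZ ger0_norm ?invr_ge0 1?ltW// mulrC enormB.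
  (* Adding the inequality to its mirror image cancels the function values. *)
  have := lerD (h1 U1) (h2 U2).
  have -> : p j - p j.+1 = - (p j.+1 - p j) by rewrite opprB.
  rewrite pS dotpNr !dotpZr => h.
  rewrite -(ler_pM2l (_ : 0 < L^-1)) ?invr_gt0//.
  have -> : L^-1 * (L / N%:R * dotp (g (p j.+1) - g (p j)) (y - x)) =
     N%:R^-1 * dotp (g (p j.+1)) (y - x) - N%:R^-1 * dotp (g (p j)) (y - x).
    by rewrite dotpDl dotpNl; field; rewrite !gt_eqF.
  have e2 a : L^-1 * a = (2 * L)^-1 * a + (2 * L)^-1 * a.
    by field; rewrite gt_eqF.
  rewrite e2; lra.
have sumE : \sum_(j < N) (g (p j.+1) - g (p j)) = g y - g x.
  rewrite -(big_mkord xpredT (fun j => g (p j.+1) - g (p j))) telescope_sumr//.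
  congr (g _ - g _); last by rewrite /p mul0r scale0r addr0.
  by rewrite /p divff ?gt_eqF// scale1r addrC subrK.
(* The factor [N] from Cauchy-Schwarz cancels the [1 / N] in [piece]. *)
have := enorm_sum_sqr_le (fun j : 'I_N => g (p j.+1) - g (p j)).
rewrite sumE card_ord => /le_trans; apply.
apply: (@le_trans _ _ (N%:R * \sum_(j < N) L / N%:R * dotp (g (p j.+1) - g (p j)) (y - x))).
  by rewrite ler_wpM2l// ler_sum// => j _; exact: piece.
rewrite -mulr_sumr.
have -> : \sum_(j < N) dotp (g (p j.+1) - g (p j)) (y - x) = dotp (g y - g x) (y - x).
  rewrite -sumE /dotp exchange_big/=; apply: eq_bigr => k _.
  by rewrite summxE mulr_suml.
by rewrite mulrA mulrCA divff ?mulr1 ?gt_eqF.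
Qed.

(** * One step of the method *)

Lemma step_radius_ge0 (R : realType) (d : nat) (u v : 'rV[R]_d) (L : R) :
  0 <= L -> 0 <= step_radius u v L.
Proof. by move=> L0; rewrite /step_radius; case: ifP => // _; rewrite divr_ge0 ?enorm_ge0. Qed.

(** For [L = 0] the quotient in [step_radius] is 0 by convention, but smoothness then forces the two
    gradients to agree. *)
Lemma step_radiusE (R : realType) (d : nat) (U : set 'rV[R]_d) g (L : R)
    (x y : 'rV[R]_d) :
  smooth_on U g L -> U x -> U y -> enorm (g x - g y) = L * step_radius (g x) (g y) L.
Proof.
move=> sg Ux Uy; rewrite /step_radius; case: eqVneq => [->|_] /=.
  by rewrite subrr -(scale0r 0) enormZ normr0 mul0r mulr0.
have [L0|L0] := eqVneq L 0; last by rewrite mulrCA divff ?mulr1.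
by apply/eqP; rewrite eq_le {3}L0 mul0r enorm_ge0 andbT (le_trans (sg _ _ Ux Uy))// L0 !mul0r.
Qed.

(* No multiplier is needed: moving from [xp] towards [y] decreases the linear
   objective unless [<g x, xp - y> = 0], so it must leave the ball at once. In the
   remaining case all estimates are equalities, and [xp] is the gradient step. *)
Lemma ball_step_decrease (R : realType) (d : nat) (X U : set 'rV[R]_d) f g (L : R)
    (x y xp : 'rV[R]_d) (t := step_radius (g x) (g y) L) :
  convex_set X -> open U -> convex_set U -> X `<=` U ->
  convex_on U f -> has_gradient_on U f g -> smooth_on U g L -> 0 <= L ->
  X x -> is_argmin X f y ->
  is_argmin (X `&` eball x t) (dotp (g x)) xp ->
  enorm (xp - y) ^+ 2 <= enorm (x - y) ^+ 2 - t ^+ 2.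
Proof.
move=> cX oU cU XU cf hg sg L0 Xx ymin [[Xxp /= xpt] xpmin].
have Xy := ymin.1.
have [gxy|gxy] := eqVneq (g x) (g y).
  have t0 : t = 0 by rewrite /t /step_radius gxy eqxx.
  have /dotp_eq0/eqP : dotp (xp - x) (xp - x) = 0.
    apply/eqP; rewrite -enorm_sqr sqrf_eq0 eq_le enorm_ge0 andbT.
    by move: xpt; rewrite /eball/= t0.
  by rewrite subr_eq0 => /eqP ->; rewrite t0 expr0n subr0.
pose w := g x - g y.
have w0 : 0 < enorm w.
  rewrite lt_neqAle enorm_ge0 andbT eq_sym; apply: contra gxy => /eqP w0.
  by rewrite -subr_eq0 -/w; apply/eqP/dotp_eq0; rewrite -enorm_sqr w0 expr0n.
have Lgt0 : 0 < L.
  rewrite lt_neqAle L0 andbT; apply: contraTneq w0 => L00.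
  by rewrite -leNgt (le_trans (sg _ _ (XU _ Xx) (XU _ Xy)))// -L00 mul0r.
have wt : enorm w = L * t := step_radiusE sg (XU _ Xx) (XU _ Xy).
have t0 : 0 <= t := step_radius_ge0 _ _ L0.
have xpt' : enorm (xp - x) ^+ 2 <= t ^+ 2 by rewrite lerXn2r ?nnegrE ?enorm_ge0.
have coco := cocoercive oU cU cf hg sg Lgt0 (XU _ Xy) (XU _ Xx).
rewrite -/w wt exprMn in coco.
have {}coco : L * t ^+ 2 <= dotp w (x - y).
  by rewrite -(ler_pM2l Lgt0) mulrA -expr2.
have first := argmin_gradient_ge0 XU cX hg ymin Xxp.
have csw : - (L * t ^+ 2) <= dotp w (xp - x).
  apply: le_trans (dotp_ge w _); rewrite lerN2 wt expr2 mulrA.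
  by rewrite ler_wpM2l// mulr_ge0.
(* By [csw], [coco] and [first] the summands are at least [- (L * t ^+ 2)], [L * t ^+ 2] and 0, so
   the left side is nonnegative, and zero only if all three bounds are attained. *)
have gap : dotp (g x) (xp - y) = dotp w (xp - x) + dotp w (x - y) + dotp (g y) (xp - y).
  by rewrite /w !dotpE; ring.
(* This is the claim after expanding [x - y] through [xp]. *)
have key : t ^+ 2 <= enorm (xp - x) ^+ 2 + 2 * dotp (xp - x) (y - xp).
  have [gap0|gap0] := leP (dotp (g x) (xp - y)) 0.
    have wxp : dotp w (xp - x) = - (L * t ^+ 2) by lra.
    have wxy : dotp w (x - y) = L * t ^+ 2 by lra.
    (* The squared norm is at most [L^2 t^2 - 2 L^2 t^2 + L^2 t^2 = 0]. *)
    have Lxp : L *: (xp - x) + w = 0.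
      apply: dotp_eq0; apply/eqP; rewrite eq_le dotp_ge0 andbT.
      have -> : dotp (L *: (xp - x) + w) (L *: (xp - x) + w) =
          L ^+ 2 * enorm (xp - x) ^+ 2 + 2 * L * dotp w (xp - x) + enorm w ^+ 2.
        by rewrite -enorm_sqr (enorm_sqrD (L *: _)) enormZ exprMn real_normK ?num_real// dotpZl (dotpC w); ring.
      have := ler_wpM2l (sqr_ge0 L) xpt'; rewrite wxp wt; lra.
    have xpE : xp - x = - L^-1 *: w.
      rewrite -[w](addKr (L *: (xp - x))) Lxp addr0 scalerN scaleNr opprK scalerA.
      by rewrite mulVf ?scale1r ?gt_eqF.
    have -> : y - xp = - (x - y) - (xp - x) by apply/rowP => j; rewrite !mxE; ring.
    rewrite dotpDr !dotpNr -enorm_sqr.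
    have -> : dotp (xp - x) (x - y) = - t ^+ 2.
      by rewrite xpE dotpZl wxy; field; rewrite gt_eqF.
    lra.
  pose c := enorm (y - xp) ^+ 2; pose b := dotp (xp - x) (y - xp).
  have c0 : 0 <= c := sqr_ge0 _.
  have outside N : (0 < N)%N ->
      t ^+ 2 <= enorm (xp - x) ^+ 2 + N%:R^-1 * (2 * b + c / N%:R).
    move=> N0; have N0' : 0 < N%:R :> R by rewrite ltr0n.
    pose z := xp + N%:R^-1 *: (y - xp).
    have Xz : X z.
      apply: (convex_segment cX Xxp); rewrite ?invr_ge0 ?invf_le1 ?ler1n ?ler0n//.
      by rewrite addrC subrK.
    have zfar : t <= enorm (z - x).
      rewrite leNgt; apply/negP => /ltW zt.
      have := xpmin z (conj Xz zt); rewrite /z dotpDr lerDl dotpZr pmulr_rge0 ?invr_gt0//.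
      by rewrite -opprB dotpNr oppr_ge0 leNgt gap0.
    have : t ^+ 2 <= enorm (z - x) ^+ 2 by rewrite lerXn2r ?nnegrE ?enorm_ge0.
    move=> /le_trans; apply; rewrite le_eqVlt; apply/orP; left; apply/eqP.
    have -> : z - x = (xp - x) + N%:R^-1 *: (y - xp) by rewrite /z addrAC.
    rewrite enorm_sqrD enormZ exprMn real_normK ?num_real// dotpZr -/b -/c.
    by field; rewrite gt_eqF.
  (* Since [enorm (xp - x) <= t], [outside] leaves [0 <= 2 * b + c / N]; let [N] grow. *)
  have b0 : 0 <= 2 * b.
    apply: (le_add_div_nat c0) => N N0.
    have N0' : 0 < N%:R^-1 :> R by rewrite invr_gt0 ltr0n.
    by rewrite -(pmulr_rge0 _ N0'); have := outside N N0; lra.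
  (* A second limit in [outside] shows that [xp] lies on the sphere of radius [t]. *)
  suff : t ^+ 2 <= enorm (xp - x) ^+ 2 by rewrite -/b; lra.
  apply: (@le_add_div_nat _ _ _ (2 * b + c)); first lra.
  move=> N N0; apply: (le_trans (outside N N0)).
  rewrite lerD2l mulrC ler_wpM2r ?invr_ge0 ?ler0n// lerD2l.
  by rewrite ler_pdivrMr ?ltr0n// ler_peMr// ler1n.
rewrite (enormB xp) (enormB x).
have -> : y - x = (xp - x) + (y - xp) by rewrite [RHS]addrC addrA subrK.
by rewrite (enorm_sqrD (xp - x)); lra.
Qed.

Lemma decrease_shift_center (R : realType) (d : nat) (x xp y z : 'rV[R]_d) (t D : R) :
  0 <= D -> enorm (y - z) <= D -> enorm (xp - x) <= t ->
  enorm (xp - y) ^+ 2 <= enorm (x - y) ^+ 2 - t ^+ 2 ->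
  enorm (xp - z) ^+ 2 <= enorm (x - z) ^+ 2 - t ^+ 2 / 2 + 2 * D ^+ 2.
Proof.
move=> D0 yD xpt.
have xz : xp - z = (xp - x) + (x - z) by rewrite addrA subrK.
have xy : xp - y = (xp - x) + (x - z) - (y - z).
  by apply/rowP => j; rewrite !mxE; ring.
have xy' : x - y = (x - z) - (y - z) by apply/rowP => j; rewrite !mxE; ring.
have h : dotp (xp - x) (y - z) <= t * D.
  by rewrite (le_trans (dotp_le _ _))// ler_pM ?enorm_ge0.
(* Young's inequality [2 t D <= t^2 / 2 + 2 D^2] keeps half of the decrease [t^2]. *)
have := sqr_ge0 (t - 2 * D).
rewrite xz xy xy' !enorm_sqr; move: (xp - x) (x - z) (y - z) h => u v w.
rewrite !dotpE (dotpC v u) (dotpC w u) (dotpC w v); lra.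
Qed.

Lemma enorm_sqrD_le (R : realType) (d : nat) (u v : 'rV[R]_d) :
  enorm (u + v) ^+ 2 <= 2 * enorm u ^+ 2 + 2 * enorm v ^+ 2.
Proof.
have := dotp_ge0 (u - v); rewrite !enorm_sqr !dotpE (dotpC v u); lra.
Qed.

(** * Averages over sampling histories *)

Lemma big_tuple_rcons (R : realType) (I : finType) (k : nat) (F : seq I -> R) :
  \sum_(s : k.+1.-tuple I) F s = \sum_(s : k.-tuple I) \sum_i F (rcons s i).
Proof.
rewrite pair_big /=.
pose h (p : k.-tuple I * I) : k.+1.-tuple I := [tuple of rcons p.1 p.2].
pose h' (s : k.+1.-tuple I) : k.-tuple I * I :=
  ([tuple of belast (thead s) (behead s)], last (thead s) (behead s)).
rewrite (reindex h)//; exists h' => [[s i] _|s _].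
  rewrite /h /h'; congr pair.
    apply: val_inj => /=; rewrite /thead (tnth_nth i) /=.
    by case: s => -[|a s] //= _; rewrite ?belast_rcons.
  rewrite /thead (tnth_nth i) /=.
  by case: s => -[|a s] //= _; rewrite ?last_rcons.
apply: val_inj => /=; rewrite -lastI; case: s => -[|a s] //= sz.
Qed.

(** Independent uniform indices make the history uniform on the [n ^ k] tuples, so this is the
    expectation of a function of the first [k] samples. *)
Definition history_mean {R : realType} {n : nat} (k : nat) (F : seq 'I_n -> R) : R :=
  (n ^ k)%:R^-1 * \sum_(s : k.-tuple 'I_n) F s.

Lemma history_mean0 (R : realType) (n : nat) (F : seq 'I_n -> R) :
  history_mean 0 F = F [::].
Proof.
rewrite /history_mean expn0 invr1 mul1r (bigD1 [tuple])//= big1 ?addr0//.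
by move=> s; rewrite tuple0.
Qed.

(** Tower property: the inner average over [i] is the conditional expectation given the past [s]. *)
Lemma history_meanS (R : realType) (n k : nat) (F : seq 'I_n -> R) :
  history_mean k.+1 F = history_mean k (fun s => n%:R^-1 * \sum_i F (rcons s i)).
Proof.
by rewrite /history_mean big_tuple_rcons expnSr natrM invfM -mulrA mulr_sumr.
Qed.

Lemma le_history_mean (R : realType) (n k : nat) (F G : seq 'I_n -> R) :
  (forall s, F s <= G s) -> history_mean k F <= history_mean k G.
Proof. by move=> FG; rewrite ler_wpM2l ?invr_ge0// ler_sum. Qed.

Lemma history_meanD (R : realType) (n k : nat) (F G : seq 'I_n -> R) :
  history_mean k (fun s => F s + G s) = history_mean k F + history_mean k G.
Proof. by rewrite /history_mean big_split mulrDr. Qed.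

Lemma history_meanZ (R : realType) (n k : nat) (a : R) (F : seq 'I_n -> R) :
  history_mean k (fun s => a * F s) = a * history_mean k F.
Proof. by rewrite /history_mean -mulr_sumr mulrCA. Qed.

Lemma history_mean_cst (R : realType) (n k : nat) (a : R) :
  (0 < n)%N -> history_mean k (fun _ : seq 'I_n => a) = a.
Proof.
move=> n0; rewrite /history_mean sumr_const card_tuple card_ord -[a *+ _]mulr_natl.
by rewrite mulKf// pnatr_eq0 -lt0n expn_gt0 n0.
Qed.

(** Jensen's inequality for the square, which turns a second-moment bound into one on the expected
    norm. *)
Lemma sqr_history_mean_le (R : realType) (n k : nat) (F : seq 'I_n -> R) :
  (0 < n)%N -> history_mean k F ^+ 2 <= history_mean k (fun s => F s ^+ 2).
Proof.
move=> n0; have N0 : 0 < (n ^ k)%:R :> R by rewrite ltr0n expn_gt0 n0.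
have := sqr_sum_le (fun s : k.-tuple 'I_n => F s).
rewrite card_tuple card_ord /history_mean exprMn => h.
rewrite -ler_pdivlMl ?exprn_gt0 ?invr_gt0//; apply: (le_trans h).
rewrite le_eqVlt; apply/orP; left; apply/eqP.
by field; rewrite gt_eqF.
Qed.

Lemma exists_le_of_sum_le (R : realType) (K : nat) (a : nat -> R) (B : R) :
  (0 < K)%N -> \sum_(k < K) a k <= K%:R * B -> exists2 k, (k < K)%N & a k <= B.
Proof.
move=> K0 sB; have [[k ak]|nex] := pselect (exists k : 'I_K, a k <= B).
  by exists k.
suff : K%:R * B < \sum_(k < K) a k by rewrite ltNge sB.
rewrite mulr_natl -[X in B *+ X]card_ord -sumr_const.
apply: ltr_sum; first by apply/hasP; exists (Ordinal K0); rewrite ?mem_index_enum.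
by move=> k _; rewrite ltNge; apply/negP => ak; apply: nex; exists k.
Qed.

(** * The convergence bound *)

Unset Implicit Arguments.

Theorem theorem14 (R : realType) (d n : nat) (hn : (0 < n)%N)
  (X U : set 'rV[R]_d)
  (hXne : X !=set0) (hXcl : closed X) (hXcv : convex_set X)
  (hUop : open U) (hUcv : convex_set U) (hXU : X `<=` U)
  (f : 'I_n -> 'rV[R]_d -> R) (grad : 'I_n -> 'rV[R]_d -> 'rV[R]_d)
  (L : 'I_n -> R)
  (hL : forall i, 0 <= L i)
  (hconv : forall i, convex_on U (f i))
  (hdiff : forall i, has_gradient_on U (f i) (grad i))
  (hsmooth : forall i, smooth_on U (grad i) (L i))
  (xstar : 'rV[R]_d)
  (hxstar : is_argmin X (fun x => n%:R^-1 * \sum_(i < n) f i x) xstar)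
  (xs : 'I_n -> 'rV[R]_d)
  (hxs : forall i, is_argmin X (f i) (xs i))
  (x0 : 'rV[R]_d) (hx0 : X x0)
  (* iterates x_k as a function of the sampled history [:: i_0; ...; i_{k-1}] *)
  (xit : seq 'I_n -> 'rV[R]_d)
  (hinit : xit [::] = x0)
  (hstep : forall (s : seq 'I_n) (i : 'I_n),
     is_argmin (X `&` eball (xit s)
                  (step_radius (grad i (xit s)) (grad i (xs i)) (L i)))
               (fun z => dotp (grad i (xit s)) z) (xit (rcons s i)))
  (K : nat) (hK : (0 < K)%N) :
  let gradF := fun x => n%:R^-1 *: \sum_(i < n) grad i x in
  let D := \big[Num.max/0]_(i < n) enorm (xs i - xstar) in
  let Lmax := \big[Num.max/0]_(i < n) L i in
  let Lbar2sq := n%:R^-1 * \sum_(i < n) L i ^+ 2 in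
  let Enorm := fun k : nat =>
     (n ^ k)%:R^-1 * \sum_(s : k.-tuple 'I_n) enorm (gradF (xit s) - gradF xstar) in
  exists2 k : nat, (k < K)%N &
    Enorm k <= Num.sqrt (4 * Lmax ^+ 2 * enorm (x0 - xstar) ^+ 2 / K%:R
                         + (8 * Lmax ^+ 2 + 2 * Lbar2sq) * D ^+ 2).
Proof.
move=> gradF D Lmax Lbar2sq Enorm.
have n0 : 0 < n%:R^-1 :> R by rewrite invr_gt0 ltr0n.
have D0 : 0 <= D by exact: bigmax_ge_id.
have Lmax0 : 0 <= Lmax by exact: bigmax_ge_id.
have hD i : enorm (xs i - xstar) <= D by exact: le_bigmax.
have hLmax i : L i <= Lmax by exact: le_bigmax.
have Xit s : X (xit s).
  by case/lastP: s => [|s i]; [rewrite hinit | case: (hstep s i) => -[]].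
pose t s i := step_radius (grad i (xit s)) (grad i (xs i)) (L i).
pose V s := enorm (xit s - xstar) ^+ 2.
pose G s := enorm (gradF (xit s) - gradF xstar).
have decrease s i : V (rcons s i) <= V s - t s i ^+ 2 / 2 + 2 * D ^+ 2.
  apply: (decrease_shift_center D0 (hD i)); first by case: (hstep s i) => -[].
  exact: (ball_step_decrease hXcv hUop hUcv hXU (hconv i) (hdiff i) (hsmooth i)
    (hL i) (Xit s) (hxs i) (hstep s i)).
(* Pass through the gradient at [xs i]. The second term keeps [L i] instead of [Lmax], so that
   averaging over [i] produces [Lbar2sq]. *)
have gap s i : enorm (grad i (xit s) - grad i xstar) ^+ 2 <=
    2 * Lmax ^+ 2 * t s i ^+ 2 + 2 * L i ^+ 2 * D ^+ 2.
  have -> : grad i (xit s) - grad i xstar =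
    (grad i (xit s) - grad i (xs i)) + (grad i (xs i) - grad i xstar).
    by rewrite addrA subrK.
  apply: (le_trans (enorm_sqrD_le _ _)); rewrite -!(mulrA 2).
  have Uxs : U (xs i) by apply: hXU; case: (hxs i).
  have Ustar : U xstar by apply: hXU; case: hxstar.
  apply: lerD; rewrite ler_pM2l// -exprMn lerXn2r ?nnegrE ?mulr_ge0 ?enorm_ge0 ?step_radius_ge0//.
    rewrite (step_radiusE (hsmooth i) (hXU _ (Xit s)) Uxs).
    by rewrite ler_wpM2r ?step_radius_ge0.
  by rewrite (le_trans (hsmooth i _ _ Uxs Ustar))// ler_wpM2l.
pose W s := n%:R^-1 * \sum_i V (rcons s i).
(* The term [2 * Lmax ^+ 2 * t s i ^+ 2] of [gap] is [4 * Lmax ^+ 2] times the [t^2 / 2] controlled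
   by [decrease], whose [2 * D ^+ 2] becomes [8 * Lmax ^+ 2 * D ^+ 2]. *)
have step s : G s ^+ 2 <= 4 * Lmax ^+ 2 * V s +
    - (4 * Lmax ^+ 2) * W s +
    (8 * Lmax ^+ 2 + 2 * Lbar2sq) * D ^+ 2.
  have Gs : G s ^+ 2 <= n%:R^-1 * \sum_i enorm (grad i (xit s) - grad i xstar) ^+ 2.
    rewrite /G /gradF -scalerBr -sumrB enormZ (gtr0_norm n0) exprMn.
    have := enorm_sum_sqr_le (fun i => grad i (xit s) - grad i xstar).
    rewrite card_ord => /(ler_wpM2l (sqr_ge0 n%:R^-1)) /le_trans; apply.
    by rewrite mulrA expr2 -(mulrA n%:R^-1) mulVf ?mulr1// pnatr_eq0 -lt0n.
  apply: (le_trans Gs).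
  have -> : 4 * Lmax ^+ 2 * V s +
    - (4 * Lmax ^+ 2) * W s +
    (8 * Lmax ^+ 2 + 2 * Lbar2sq) * D ^+ 2 = n%:R^-1 * \sum_i
      (4 * Lmax ^+ 2 * V s + 8 * Lmax ^+ 2 * D ^+ 2 - 4 * Lmax ^+ 2 * V (rcons s i)
        + 2 * D ^+ 2 * L i ^+ 2).
    rewrite big_split sumrB /= sumr_const card_ord -mulr_natl -!mulr_sumr /Lbar2sq /W.
    by field; rewrite pnatr_eq0 -lt0n.
  rewrite ler_pM2l// ler_sum// => i _; apply: (le_trans (gap s i)).
  have := ler_wpM2l (sqr_ge0 Lmax) (decrease s i); lra.
have mean_step k : Enorm k ^+ 2 <= 4 * Lmax ^+ 2 * history_mean k V -
    4 * Lmax ^+ 2 * history_mean k.+1 V + (8 * Lmax ^+ 2 + 2 * Lbar2sq) * D ^+ 2.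
  apply: (le_trans (sqr_history_mean_le k G hn)).
  apply: (le_trans (le_history_mean k step)).
  rewrite !history_meanD (history_meanZ k (4 * _)) (history_meanZ k (- _)).
  by rewrite history_mean_cst// (history_meanS k V) mulNr.
have V0 k : 0 <= history_mean k V.
  by rewrite mulr_ge0 ?invr_ge0// sumr_ge0// => s _; exact: sqr_ge0.
(* The index is chosen for the squares [Enorm k ^+ 2]; the square root is taken at the end. *)
have [|k kK hk] := @exists_le_of_sum_le R K (fun k => Enorm k ^+ 2)
    (4 * Lmax ^+ 2 * enorm (x0 - xstar) ^+ 2 / K%:R
      + (8 * Lmax ^+ 2 + 2 * Lbar2sq) * D ^+ 2) hK.
  apply: (@le_trans _ _ (\sum_(k < K) (4 * Lmax ^+ 2 * history_mean k V -
    4 * Lmax ^+ 2 * history_mean k.+1 V + (8 * Lmax ^+ 2 + 2 * Lbar2sq) * D ^+ 2))).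
    exact: ler_sum.
  rewrite big_split /= sumr_const card_ord mulrDr -[X in _ + X <= _]mulr_natl lerD2r.
  rewrite [K%:R * _]mulrC divfK ?pnatr_eq0 -?lt0n//.
  (* The sum telescopes to the value at time 0 minus the one at time [K], which is dropped as
     nonnegative. *)
  under eq_bigr do rewrite -opprB.
  rewrite sumrN -(big_mkord xpredT (fun k => 4 * Lmax ^+ 2 * history_mean k.+1 V -
    4 * Lmax ^+ 2 * history_mean k V)) telescope_sumr// opprB history_mean0 /V hinit.
  by rewrite gerBl mulr_ge0// mulr_ge0 ?sqr_ge0.
by exists k => //; rewrite (le_trans (ler_norm _))// -sqrtr_sqr ler_wsqrtr.
Qed.
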